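(* Let $p>0$, $a>0$ and let $\rho(x)=|x|^p+a$ on $\mathbb{R}$. Let $[\alpha_i,\beta_i]$, $\alpha_i<\beta_i$, $1\le i\le N$, be any finite collection of pairwise non-overlapping intervals in $\mathbb{R}$. Then there is a single interval $[\alpha,\beta]$ with $\alpha\le 0$ and $\beta>0$ (so that it includes the origin) whose weighted mass equals the total weighted mass of the collection and whose weighted perimeter is less than or equal to the total weighted perimeter of the collection.
   Context: For a density $\rho$ on $\mathbb{R}$, an interval $[\alpha,\beta]$ has weighted perimeter $\rho(\alpha)+\rho(\beta)$ and weighted mass $\int_\alpha^\beta\rho(x)\,dx$. The total weighted perimeter (respectively mass) of a finite collection of intervals is the sum of the weighted perimeters (respectively masses) of its members. Intervals are non-overlapping if their interiors are disjoint. *)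

(* Defs.v *)
From HB Require Import structures.
From mathcomp Require Import all_boot all_order all_algebra.
From mathcomp Require Import all_classical all_reals all_analysis.

Set Implicit Arguments.
Unset Strict Implicit.
Unset Printing Implicit Defensive.

Import Order.TTheory GRing.Theory Num.Theory.
Import numFieldNormedType.Exports.

Local Open Scope classical_set_scope.
Local Open Scope ring_scope.

(* Library convention: [0 `^ p = 0] whenever [p != 0], so that
   [power_density p a 0 = a] for every [p > 0]. *)
Definition power_density (R : realType) (p a : R) (x : R) : R :=
  `|x| `^ p + a.

Definition wperimeter (R : realType) (rho : R -> R) (alpha beta : R) : R :=
  rho alpha + rho beta.

(* Kept in [\bar R], so that no finiteness is built into the definition. *)
Definition wmass (R : realType) (rho : R -> R) (alpha beta : R) : \bar R :=
  (\int[lebesgue_measure]_(x in `[alpha, beta]) (rho x)%:E)%E.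

Definition nonoverlapping (R : realType) (A B : set R) : Prop :=
  A° `&` B° = set0.

(* Main.v *)
Require Import Defs.
From HB Require Import structures.
From mathcomp Require Import all_boot all_order all_algebra.
From mathcomp Require Import all_classical all_reals all_analysis.
From mathcomp Require Import measurable_realfun lra.

Set Implicit Arguments.
Unset Strict Implicit.
Unset Printing Implicit Defensive.

Import Order.TTheory GRing.Theory Num.Theory.
Import numFieldNormedType.Exports.

Local Open Scope classical_set_scope.
Local Open Scope ring_scope.

(** Only three features of [|x|^p + a] matter: it is measurable, positive at the
origin, and nondecreasing in [|x|]; the argument works for any such density.

Let [A] be the leftmost and [B] the rightmost endpoint of the collection.  The
intervals are disjoint up to endpoints and lie in [[A, B]], so their total mass
[m] is at most the mass of [[A, B]] ([sum_wmass_le_hull]); and [A], [B] are a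
left and a right endpoint occurring in the collection, so [rho A + rho B] is
at most the total perimeter.  It remains to replace [[A, B]] by an interval
around the origin of mass exactly [m] without increasing the perimeter.

If [[A, B]] misses the origin, it is replaced by an interval ending there, of
no smaller mass and no larger perimeter ([centred_hull]): when it lies on the
positive side, [A] is moved to [0], where [rho] is minimal; when it lies on the
negative side, it is reflected as well, [rho] being even.  An interval around
the origin can be shrunk towards [0] until its mass is exactly [m], because the
mass is continuous in the endpoints; the endpoints only approach [0], so the
perimeter does not increase ([trim_interval]). *)

Section radial.
Context {R : realType}.
Notation mu := (@lebesgue_measure R).
Implicit Types (rho : R -> R) (u v w x y : R).

(** The third clause also makes [rho] even, and bounds it on every segment. *)
Definition radial_density rho : Prop :=
  [/\ measurable_fun [set: R] rho, 0 < rho 0 &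
      forall x y, `|x| <= `|y| -> rho x <= rho y].

Lemma radial_density_gt0 rho x : radial_density rho -> 0 < rho x.
Proof.
by case=> _ r0 mono; apply: lt_le_trans (mono 0 x _) => //; rewrite normr0.
Qed.

Lemma radial_density_even rho x : radial_density rho -> rho (- x) = rho x.
Proof. by case=> _ _ mono; apply/le_anti; rewrite !mono// normrN. Qed.

Lemma radial_density_measurable rho (D : set R) :
  radial_density rho -> measurable_fun D (EFin \o rho).
Proof. by case=> mrho _ _; apply/measurable_EFinP; exact: measurable_funTS. Qed.

Lemma radial_density_integrable rho u v : radial_density rho ->
  mu.-integrable `[u, v] (EFin \o rho).
Proof.
move=> hr; have [mrho _ mono] := hr.
apply: measurable_bounded_integrable => //.
- by rewrite /= lebesgue_measure_itv/=; case: ifPn => // _; rewrite -EFinB ltry.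
- exact: measurable_funTS.
(* Every point of [[u, v]] has absolute value at most [|u| + |v|]. *)
exists (rho (`|u| + `|v|)); split; first exact: num_real.
move=> K hK x /=; rewrite in_itv/= => /andP[ux xv].
rewrite gtr0_norm ?radial_density_gt0//; apply: le_trans (ltW hK).
apply: mono; rewrite [leRHS]ger0_norm ?addr_ge0//.
have := ler_norm v; have := ler_norm (- u); rewrite normrN.
have := normr_ge0 u; have := normr_ge0 v.
by rewrite ler_norml => *; apply/andP; split; lra.
Qed.

Lemma wmass_ge0 rho u v : radial_density rho -> (0 <= wmass rho u v)%E.
Proof.
by move=> hr; apply: integral_ge0 => x _; rewrite lee_fin ltW// radial_density_gt0.
Qed.

Lemma wmass_fin_num rho u v : radial_density rho -> wmass rho u v \is a fin_num.
Proof.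
by move=> hr; exact: integrable_fin_num (radial_density_integrable _ _ hr).
Qed.

Lemma wmass_mono rho u v u' v' : radial_density rho -> u' <= u -> v <= v' ->
  (wmass rho u v <= wmass rho u' v')%E.
Proof.
move=> hr uu vv; apply: ge0_subset_integral => //.
- exact: radial_density_measurable.
- by move=> x _; rewrite lee_fin ltW// radial_density_gt0.
- by apply: subset_itvScc; rewrite bnd_simp.
Qed.

(** The shared endpoint [v] is dropped from the right-hand piece to make the two
pieces disjoint; a point has Lebesgue measure zero. *)
Lemma wmass_split rho u v w : radial_density rho -> u <= v -> v <= w ->
  wmass rho u w = (wmass rho u v + wmass rho v w)%E.
Proof.
move=> hr uv vw; rewrite /wmass.
rewrite (@itv_bndbnd_setU _ _ _ (BRight v)) ?bnd_simp//.
rewrite ge0_integral_setU//=.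
- by congr (_ + _)%E; rewrite integral_itv_obnd_cbnd//; exact: radial_density_measurable.
- exact: radial_density_measurable.
- by move=> x _; rewrite lee_fin ltW// radial_density_gt0.
- by apply/disj_set2P; rewrite -subset0 => x /=; rewrite !in_itv/= => -[/andP[_ +] /andP[+ _]];
  rewrite leNgt => /negP.
Qed.

(** Lebesgue measure is its own image under [x |-> - x] and [rho] is even. *)
Lemma wmass_opp rho u v : radial_density rho ->
  wmass rho (- v) (- u) = wmass rho u v.
Proof.
move=> hr; rewrite /wmass.
have -> : `[- v, - u]%classic = (-%R : R -> measurableTypeR R) @^-1` `[u, v]%classic.
  by rewrite opp_preimage_itvbndbnd.
under eq_integral do rewrite -(radial_density_even _ hr).
rewrite -(@ge0_integral_pushforward _ _ _ (measurableTypeR R) _ _ _ _ _ (EFin \o rho))//=.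
- by apply: eq_measure_integral => //= A mA _; exact: lebesgue_measureN.
- exact: radial_density_measurable.
- by move=> x _; rewrite lee_fin ltW// radial_density_gt0.
Qed.

(** The minimum [rho 0] of the density is positive, and the mass is at least
[rho 0 * (v - u)]. *)
Lemma wmass_gt0 rho u v : radial_density rho -> u < v -> (0 < wmass rho u v)%E.
Proof.
move=> hr uv; have [_ r0 mono] := hr.
apply: (@lt_le_trans _ _ (\int[mu]_(x in `[u, v]) (rho 0)%:E)%E).
  rewrite integral_cst//= lebesgue_measure_itv/= lte_fin uv -EFinB -EFinM lte_fin.
  by rewrite mulr_gt0// subr_gt0.
apply: ge0_le_integral => //=.
- by move=> x _; rewrite lee_fin ltW.
- exact: radial_density_measurable.
- by move=> x _; rewrite lee_fin mono// normr0.
Qed.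

(** An integral depends continuously on its upper bound, so the intermediate
value theorem applies between [wmass rho u u = 0] and [wmass rho u v]. *)
Lemma wmass_IVT rho u v (m : \bar R) : radial_density rho -> u <= v ->
  (0 <= m <= wmass rho u v)%E ->
  exists w, [/\ u <= w, w <= v & wmass rho u w = m].
Proof.
move=> hr uv /andP[m0 mM].
have mfin : m \is a fin_num.
  by rewrite ge0_fin_numE// (le_lt_trans mM)// ltey_eq wmass_fin_num.
have E w : wmass rho u w = (parameterized_integral mu u w rho)%:E.
  by rewrite /parameterized_integral /Rintegral fineK//; exact: wmass_fin_num.
have pu : parameterized_integral mu u u rho = 0.
  by rewrite /parameterized_integral set_itv1 Rintegral_set1.
have pv : fine m <= parameterized_integral mu u v rho.
  by rewrite -lee_fin -E fineK.
have pm : 0 <= fine m by exact: fine_ge0.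
have [|w] := @IVT _ _ u v (fine m) uv
  (parameterized_integral_continuous uv (radial_density_integrable _ _ hr)).
  by rewrite pu min_l ?max_r ?pm// (le_trans pm).
rewrite in_itv/= => /andP[uw wv] pw; exists w; split => //.
by rewrite E pw fineK.
Qed.

(** Non-overlapping segments may share endpoints, so the integrals are taken over
their interiors, which are disjoint; the masses do not change. *)
Lemma sum_wmass_le_hull rho (N : nat) (al be : 'I_N -> R) A B :
  radial_density rho ->
  (forall i j, i != j -> nonoverlapping `[al i, be i] `[al j, be j]) ->
  (forall i, A <= al i) -> (forall i, be i <= B) ->
  (\sum_(i < N) wmass rho (al i) (be i) <= wmass rho A B)%E.
Proof.
move=> hr dis hA hB.
have -> : (\sum_(i < N) wmass rho (al i) (be i) =
    \sum_(i <- enum 'I_N) \int[mu]_(x in `]al i, be i[) (rho x)%:E)%E.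
  rewrite -big_enum; apply: eq_bigr => i _; rewrite /wmass.
  by rewrite integral_itv_bndoo//; exact: radial_density_measurable.
rewrite -ge0_integral_bigsetU//.
- apply: ge0_subset_integral => //.
  + by apply: bigsetU_measurable => i _.
  + exact: radial_density_measurable.
  + by move=> x _; rewrite lee_fin ltW// radial_density_gt0.
  + rewrite -bigcup_seq => x [i _] /=; rewrite !in_itv/= => /andP[ax xb].
    by rewrite (le_trans (hA i) (ltW ax)) (le_trans (ltW xb) (hB i)).
- exact: enum_uniq.
- apply/trivIsetP => i j _ _ ij.
  by have := dis _ _ ij; rewrite /nonoverlapping !interior_itv_bnd.
- exact: radial_density_measurable.
- by move=> x _; rewrite lee_fin ltW// radial_density_gt0.
Qed.

(** If [[0, B]] already has mass at least [m], the left endpoint is taken to be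
[0] and the right one is found by the intermediate value theorem.  Otherwise
[B] is kept and the left endpoint [w] is chosen to leave mass [m] on [[w, B]];
then [w <= 0], since [[0, B]] has mass less than [m]. *)
Lemma trim_interval rho A B (m : \bar R) : radial_density rho ->
  A <= 0 -> 0 < B -> (0 < m <= wmass rho A B)%E ->
  exists alpha beta, [/\ alpha <= 0, 0 < beta, wmass rho alpha beta = m &
    wperimeter rho alpha beta <= wperimeter rho A B].
Proof.
move=> hr A0 B0 /andP[m0 mM]; have [_ _ mono] := hr.
have [m0B|Bm] := leP m (wmass rho 0 B).
  have [|b [b0 bB mb]] := @wmass_IVT rho 0 B m hr (ltW B0).
    by rewrite (ltW m0) m0B.
  exists 0, b; split => //.
    rewrite lt_neqAle b0 andbT; apply: contraTneq m0 => b00.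
    by rewrite -mb -b00 /wmass set_itv1 integral_set1 ltxx.
  by apply: lerD; apply: mono; rewrite ?normr0// !ger0_norm// ltW.
have AB := le_trans A0 (ltW B0).
have Mfin := wmass_fin_num A B hr.
have mfin : m \is a fin_num.
  by rewrite ge0_fin_numE ?ltW// (le_lt_trans mM)// ltey_eq Mfin.
have [|w [Aw wB mw]] := @wmass_IVT rho A B (wmass rho A B - m)%E hr AB.
  by rewrite sube_ge0 ?mM ?mfin//= leeBlDr// leeDl// ltW.
have wBm : wmass rho w B = m.
  move: (wmass_split hr Aw wB) Mfin; rewrite mw.
  have := wmass_fin_num w B hr; move: (wmass rho w B) (wmass rho A B) mfin.
  move=> [x| |] [y| |]//; case: m {m0 mM Bm mw} => [z| |]// _ _ /eqP.
  by rewrite -EFinB -EFinD eqe => /eqP h _; congr EFin; lra.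
have w0 : w <= 0.
  by rewrite leNgt; apply: contraTN Bm => w0; rewrite -leNgt -wBm wmass_mono// ltW.
exists w, B; split => //.
by apply: lerD => //; apply: mono; rewrite !ler0_norm// lerN2.
Qed.

(** When [B <= 0] the new interval is [[0, - A]], the mirror image of [[A, 0]];
the roles of the endpoints are then exchanged, [rho 0] being compared with
[rho B] and [rho (- A)] with [rho A]. *)
Lemma centred_hull rho A B : radial_density rho -> A < B ->
  exists A' B', [/\ A' <= 0, 0 < B', (wmass rho A B <= wmass rho A' B')%E &
    wperimeter rho A' B' <= wperimeter rho A B].
Proof.
move=> hr AB; have [_ _ mono] := hr.
have [B0|B0] := ltP 0 B.
  exists (Num.min A 0), B; split => //.
  - by rewrite ge_min lexx orbT.
  - by apply: wmass_mono => //; rewrite ge_min lexx.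
  - apply: lerD => //; apply: mono.
    by case: (leP A 0) => // _; rewrite normr0.
have A0 : A < 0 by exact: lt_le_trans AB B0.
exists 0, (- A); split => //.
- by rewrite oppr_gt0.
- by have := wmass_opp A 0 hr; rewrite oppr0 => ->; exact: wmass_mono.
- rewrite /wperimeter addrC; apply: lerD; apply: mono; rewrite ?normrN//.
  by rewrite normr0.
Qed.
End radial.

Lemma power_density_radial (R : realType) (p a : R) : 0 < p -> 0 < a ->
  radial_density (power_density p a).
Proof.
move=> p0 a0; split.
- apply: measurable_funD => //.
  by apply: (measurableT_comp (measurable_powR _)) => //; exact: measurable_normr.
- by rewrite /power_density normr0 powR0 ?gt_eqF// add0r.
- by move=> x y xy; rewrite lerD2r ge0_ler_powR// ?nnegrE// ltW.
Qed.

Theorem lemma2 (R : realType) (p a : R) (hp : 0 < p) (ha : 0 < a)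
  (N : nat) (hN : (0 < N)%N) (alpha_ beta_ : 'I_N -> R)
  (hlt : forall i : 'I_N, alpha_ i < beta_ i)
  (hdisj : forall i j : 'I_N, i != j ->
     nonoverlapping `[alpha_ i, beta_ i] `[alpha_ j, beta_ j]) :
  exists alpha beta : R,
    [/\ alpha <= 0,
        0 < beta,
        wmass (power_density p a) alpha beta =
          (\sum_(i < N) wmass (power_density p a) (alpha_ i) (beta_ i))%E &
        wperimeter (power_density p a) alpha beta <=
          \sum_(i < N) wperimeter (power_density p a) (alpha_ i) (beta_ i)].
Proof.
have hr := power_density_radial hp ha.
set rho := power_density p a in hr *.
pose i0 := Ordinal hN.
have [i _ imin] := @arg_minP _ _ _ i0 xpredT alpha_ isT.
have [j _ jmax] := @arg_maxP _ _ _ i0 xpredT beta_ isT.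
have AB : alpha_ i < beta_ j by exact: lt_le_trans (hlt i) (jmax i isT).
set m := (\sum_(i < N) _)%E.
have mle : (m <= wmass rho (alpha_ i) (beta_ j))%E.
  by apply: sum_wmass_le_hull => // k; [exact: imin|exact: jmax].
have m0 : (0 < m)%E.
  rewrite /m (bigD1 i0)//= -[ltLHS]adde0 lte_leD ?wmass_gt0//.
  by apply: sume_ge0 => k _; exact: wmass_ge0.
have [A' [B' [A'0 B'0 mAB pAB]]] := centred_hull hr AB.
have [|al [be [al0 be0 mal pal]]] := @trim_interval _ _ _ _ m hr A'0 B'0.
  by rewrite m0 (le_trans mle).
exists al, be; split => //; apply: (le_trans pal); apply: (le_trans pAB).
(* The left and right endpoints are summed separately, as the extreme ones [i]
   and [j] may belong to different intervals. *)
rewrite /wperimeter big_split/= (bigD1 i)//= [X in _ <= _ + X](bigD1 j)//=.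
by apply: lerD; rewrite lerDl; apply: sumr_ge0 => k _;
  rewrite ltW// radial_density_gt0.
Qed.
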